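(* Let $(V,\Omega)$ be a symplectic vector space and let $\theta$ be the canonical Liouville form on $V$, given by $\theta_z(v_z)=\frac12\Omega(z,v)$ for $z,v\in V$. Then $${\rm Aut}(V,\theta)={\rm Sp}(V,\Omega).$$
   Context: A symplectic vector space $(V,\Omega)$ is a finite-dimensional real vector space $V$ with a nonsingular alternating bilinear form $\Omega$. Regard $V$ as a smooth manifold; for $z,v\in V$ let $v_z\in T_zV$ be the tangent vector given by $v_z\psi=\frac{\rm d}{{\rm d}t}\psi(z+tv)|_{t=0}$ for smooth $\psi:V\to\mathbb{R}$. ${\rm Sp}(V,\Omega)$ is the group of linear automorphisms $g$ of $V$ with $\Omega(gx,gy)=\Omega(x,y)$ for all $x,y\in V$. For a one-form $\theta$ on $V$, ${\rm Aut}(V,\theta)$ is the group of all diffeomorphisms $g:V\to V$ with $g^*\theta=\theta$. *)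

(* Defs.v *)
From HB Require Import structures.
From mathcomp Require Import all_boot all_order all_algebra.
From mathcomp Require Import sesquilinear.
From mathcomp Require Import boolp classical_sets functions reals.
From mathcomp Require Import topology normedtype landau derive.

Set Implicit Arguments.
Unset Strict Implicit.
Unset Printing Implicit Defensive.

Import Order.TTheory GRing.Theory Num.Theory.
Import numFieldNormedType.Exports.
Import VectorInternalTheory.
Local Open Scope classical_set_scope.
Local Open Scope ring_scope.

Section Smooth.
Context {R : realType}.

(* On a finite-dimensional domain this is the usual class C^k: the map
   x |-> 'd f x is C^k as soon as each x |-> 'd f x v = 'D_v f x is. *)
Fixpoint Ck (U W : normedModType R) (k : nat) (f : U -> W) : Prop :=
  match k with
  | 0 => continuous f
  | k'.+1 => (forall x, differentiable f x) /\
             (forall v, Ck k' (fun x => 'D_v f x))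
  end.

Definition Cinfty (U W : normedModType R) (f : U -> W) : Prop :=
  forall k, Ck k f.

(* A vectType carries no topology. Its smooth structure is the one whose
   global chart is the linear isomorphism v2r : V -> 'rV_(dim V), with inverse
   r2v; any other linear isomorphism onto a space of row vectors differs from
   it by a linear change of coordinates, hence gives the same smooth maps. *)
Definition smooth_function (V : vectType R) (psi : V -> R) : Prop :=
  Cinfty (psi \o r2v : 'rV[R]_(dim V) -> R).

Definition in_charts (V W : vectType R) (g : V -> W) :
  'rV[R]_(dim V) -> 'rV[R]_(dim W) := v2r \o g \o r2v.

Definition smooth_map (V W : vectType R) (g : V -> W) : Prop :=
  Cinfty (in_charts g).

Definition diffeomorphism (V W : vectType R) (g : V -> W) : Prop :=
  smooth_map g /\
  exists h : W -> V, [/\ cancel g h, cancel h g & smooth_map h].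

Definition tangent_vector (V : vectType R) (z v : V) : (V -> R) -> R :=
  fun psi => (fun t : R => psi (z + t *: v))^`()%classic 0.

(* The tangent map T_z V -> T_(g z) W, both tangent spaces being identified
   with the underlying vector spaces through v |-> tangent_vector z v; see
   tangent_mapE below. *)
Definition tangent_map (V W : vectType R) (g : V -> W) (z v : V) : W :=
  r2v ('d (in_charts g) (v2r z) (v2r v)).

(* form_val theta z v is the value of theta_z on tangent_vector z v. *)
Record one_form (V : vectType R) := OneForm {
  form_val :> V -> V -> R;
  form_linear : forall z, linear_for *%R (form_val z);
  form_smooth : forall v, smooth_function (fun z => form_val z v) }.

Definition pullback (V W : vectType R) (g : V -> W) (theta : one_form W) :
  V -> V -> R := fun z v => theta (g z) (tangent_map g z v).

Definition Aut (V : vectType R) (theta : one_form V) : set (V -> V) :=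
  [set g | diffeomorphism g /\ pullback g theta = theta].

Lemma derive_along (U : normedModType R) (f : U -> R) (x v : U) :
  (fun t : R => f (x + t *: v))^`()%classic 0 = 'D_v f x.
Proof.
rewrite /derive1 /derive scale0r addr0.
suff -> : (fun h : R => h^-1 *: (f (x + (h + 0) *: v) - f x)) =
          (fun h => h^-1 *: ((f \o shift x) (h *: v) - f x)) by [].
by apply/funext => h /=; rewrite addr0 (addrC x).
Qed.

Lemma tangent_mapE (V W : vectType R) (g : V -> W) (psi : W -> R) (z v : V) :
  smooth_map g -> smooth_function psi ->
  tangent_vector z v (psi \o g) = tangent_vector (g z) (tangent_map g z v) psi.
Proof.
move=> /(_ 1%N) [dg _] /(_ 1%N) [dpsi _].
have chart (X : vectType R) (f : X -> R) (x u : X) :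
    tangent_vector x u f = 'D_(v2r u) (f \o r2v) (v2r x).
  rewrite -derive_along; congr derive1; apply/funext => t /=.
  by rewrite linearD linearZ /= !v2rK.
rewrite !chart /tangent_map r2vK.
have gz : v2r (g z) = in_charts g (v2r z) by rewrite /in_charts /= v2rK.
have -> : psi \o g \o r2v = (psi \o r2v) \o in_charts g.
  by apply/funext => x; rewrite /in_charts /= v2rK.
rewrite gz !deriveE //; last exact: differentiable_comp.
by rewrite diff_comp.
Qed.

Lemma Ck_cst (U W : normedModType R) (a : W) k : Ck k (fun _ : U => a).
Proof.
elim: k a => [|k IH] a /=; first by move=> x; exact: cvg_cst.
split=> [x|v]; first exact: differentiable_cst.
by under eq_fun do rewrite derive_cst; exact: IH.
Qed.

Lemma Cinfty_linear n (f : {linear 'rV[R]_n -> R^o}) :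
  Cinfty (f : 'rV[R]_n -> R).
Proof.
have fE x : f x = \sum_i x ord0 i *: f (delta_mx 0 i).
  rewrite {1}[x]row_sum_delta linear_sum; apply: eq_bigr => i _.
  by rewrite linearZ.
have cf : continuous f.
  rewrite (_ : (f : _ -> _) =
      fun x => \sum_i x ord0 i *: f (delta_mx 0 i)); last exact/funext.
  apply: continuous_big => [|i _ x]; first exact: add_continuous.
  exact: (cvgZr_tmp (@coord_continuous R 1 n ord0 i x)).
case=> [//|k]; split=> [x|v]; first exact: linear_differentiable.
rewrite (_ : (fun x => _) = fun=> f v); first exact: Ck_cst.
apply/funext => x; rewrite deriveE ?diff_lin //; exact: linear_differentiable.
Qed.

End Smooth.

Section Symplectic.
Context {R : realType} {V : vectType R}.

Definition alternating (Omega : {biscalar V}) : Prop :=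
  forall x, Omega x x = 0.

Definition nonsingular (Omega : {biscalar V}) : Prop :=
  forall x, (forall y, Omega x y = 0) -> x = 0.

Definition symplectic_form (Omega : {biscalar V}) : Prop :=
  alternating Omega /\ nonsingular Omega.

Definition Sp (Omega : {biscalar V}) : set (V -> V) :=
  [set g | [/\ linear g, bijective g &
               forall x y, Omega (g x) (g y) = Omega x y]].

Definition liouville_val (Omega : {biscalar V}) (z v : V) : R :=
  2^-1 * Omega z v.

Fact liouville_linear Omega z : linear_for *%R (liouville_val Omega z).
Proof.
by move=> a u v; rewrite /liouville_val linearPr mulrDr mulrCA.
Qed.

Fact liouville_smooth Omega v :
  smooth_function (fun z => liouville_val Omega z v).
Proof.
pose f (x : 'rV[R]_(dim V)) : R^o := liouville_val Omega (r2v x) v.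
have lf : linear f.
  by move=> a x y; rewrite /f /liouville_val linearP linearPl mulrDr mulrCA.
pose F : {linear 'rV[R]_(dim V) -> R^o} :=
  HB.pack f (GRing.isLinear.Build _ _ _ _ f lf).
exact: (Cinfty_linear F).
Qed.

Definition liouville (Omega : {biscalar V}) : one_form V :=
  OneForm (liouville_linear Omega) (liouville_smooth Omega).

End Symplectic.

(* Main.v *)
Require Import Defs.
From HB Require Import structures.
From mathcomp Require Import all_boot all_order all_algebra.
From mathcomp Require Import sesquilinear.
From mathcomp Require Import boolp classical_sets functions reals.
From mathcomp Require Import topology normedtype derive.
From mathcomp Require Import ring lra.
Local Open Scope classical_set_scope.
Local Open Scope ring_scope.

(** A linear symplectic map is smooth, is its own tangent map, and has a linear
    inverse, so it preserves the Liouville form: only the inclusion of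
    [Aut] in [Sp] has content.

    Let [g] preserve the Liouville form, so that
    [Omega (g z) (dg_z v) = Omega z v]. The exterior derivative of that form is
    [Omega], hence [dg_z] preserves [Omega] ([tangent_symplectic]); concretely,
    one differentiates the identity in a second direction [w] and
    antisymmetrizes in [v] and [w], which removes the second derivative of [g]
    because mixed derivatives commute ([mixed_derivatives_commute]). The form
    is half the contraction of [Omega] with the Euler vector field [z |-> z],
    so [g] preserves this field too: [Omega (g z - dg_z z)] vanishes on the
    image of [dg_z], which is everything, whence [dg_z z = g z]
    ([euler_field_preserved]).

    Preserving the Euler field means being homogeneous of degree 1
    ([euler_homogeneous]), and a map that is homogeneous of degree 1 and
    differentiable at the origin equals its differential there
    ([eq_derive0]). So [g] is linear, and [g = dg_0] preserves [Omega].

    The analysis is done in the chart, for a map of row vectors and the form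
    transported from [Omega]. Vector-valued identities are tested against
    [Omega c] for all [c], which reduces them to real-valued calculus. *)

Set Implicit Arguments.
Unset Strict Implicit.
Unset Printing Implicit Defensive.

Import Order.TTheory GRing.Theory Num.Theory.
Import numFieldNormedType.Exports.
Import VectorInternalTheory.

(** * Linear maps *)

Lemma linear_rV_continuous (R : realType) (n : nat) (W : normedModType R)
  (f : {linear 'rV[R]_n -> W}) : continuous f.
Proof.
have -> : (f : _ -> _) = fun x => \sum_i x ord0 i *: f (delta_mx 0 i).
  apply/funext => x; rewrite {1}[x]row_sum_delta linear_sum.
  by apply: eq_bigr => i _; rewrite linearZ.
apply: continuous_big => [|i _ x]; first exact: add_continuous.
exact: (cvgZr_tmp (@coord_continuous R 1 n ord0 i x)).
Qed.

Lemma linear_rV_Cinfty (R : realType) (n : nat) (W : normedModType R)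
  (f : {linear 'rV[R]_n -> W}) : Cinfty f.
Proof.
have cf : continuous f by exact: linear_rV_continuous.
case=> [//|k]; split=> [x|v]; first exact: linear_differentiable.
rewrite (_ : (fun x => _) = fun=> f v); first exact: Ck_cst.
apply/funext => x; rewrite deriveE ?diff_lin //; exact: linear_differentiable.
Qed.

Lemma in_charts_linear (R : realType) (V W : vectType R) (g : V -> W) :
  linear g ->
  exists L : {linear 'rV[R]_(dim V) -> 'rV[R]_(dim W)}, in_charts g = L.
Proof.
move=> lg.
have lG : linear (in_charts g).
  by move=> a x y; rewrite /in_charts /= linearP lg linearP.
pose L : {linear 'rV[R]_(dim V) -> 'rV[R]_(dim W)} :=
  HB.pack (in_charts g) (GRing.isLinear.Build _ _ _ _ (in_charts g) lG).
by exists L.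
Qed.

Lemma smooth_linear (R : realType) (V W : vectType R) (g : V -> W) :
  linear g -> smooth_map g.
Proof.
by move=> /in_charts_linear[L E]; rewrite /smooth_map E; exact: linear_rV_Cinfty.
Qed.

Lemma tangent_map_linear (R : realType) (V W : vectType R) (g : V -> W) z v :
  linear g -> tangent_map g z v = g v.
Proof.
move=> /in_charts_linear[L E].
rewrite /tangent_map E diff_lin; last exact: linear_rV_continuous.
by rewrite -E /in_charts /= !v2rK.
Qed.

Lemma injective_linear_rV_surj (F : fieldType) (n : nat)
  (f : {linear 'rV[F]_n -> 'rV[F]_n}) :
  (forall u, f u = 0 -> u = 0) -> forall y, exists u, f u = y.
Proof.
move=> f0 y.
have M1 : lin1_mx f \in unitmx.
  rewrite -row_free_unit; apply: inj_row_free => u.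
  by rewrite mul_rV_lin1; exact: f0.
by exists (y *m invmx (lin1_mx f)); rewrite -mul_rV_lin1 mulmxKV.
Qed.

(** * Symmetry of second derivatives *)

Lemma is_derive_comp_line (R : realType) (U W : normedModType R) (f : U -> W)
  (x v : U) (t : R) (d : W) :
  is_derive (x + t *: v) v f d ->
  is_derive t 1 (fun s : R => f (x + s *: v)) d.
Proof.
move=> [df <-].
have E : (fun h : R =>
      h^-1 *: (f (x + (h *: (1 : R) + t) *: v) - f (x + t *: v))) =
    (fun h => h^-1 *: ((f \o shift (x + t *: v)) (h *: v) - f (x + t *: v))).
  by apply/funext => h /=; rewrite [h *: 1]mulr1 scalerDl addrCA.
by split; rewrite /derivable /derive /= ?E.
Qed.

Lemma is_derive_comp_shift (R : realType) (U W : normedModType R) (f : U -> W)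
  (x a v : U) (d : W) :
  is_derive (x + a) v f d -> is_derive x v (fun y => f (y + a)) d.
Proof.
move=> [df <-].
have E : (fun h : R => h^-1 *: (f (h *: v + x + a) - f (x + a))) =
    (fun h => h^-1 *: ((f \o shift (x + a)) (h *: v) - f (x + a))).
  by apply/funext => h /=; rewrite addrA.
by split; rewrite /derivable /derive /= ?E.
Qed.

Lemma MVT_line (R : realType) (U : normedModType R) (f df : U -> R) (x v : U)
  (t : R) : 0 < t -> (forall y, is_derive y v f (df y)) ->
  exists2 c, 0 < c < t & f (x + t *: v) - f x = df (x + c *: v) * t.
Proof.
move=> t0 dfE.
have D (s : R) :
    is_derive s 1 (fun s : R => f (x + s *: v)) (df (x + s *: v)).
  exact: is_derive_comp_line.
have [|c] := @MVT R (fun s : R => f (x + s *: v))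
  (fun s : R => df (x + s *: v)) 0 t t0 (fun s _ => D s).
  by apply: derivable_within_continuous => s _; apply: ex_derive.
rewrite in_itv /= scale0r addr0 subr0 => c0 E.
by exists c.
Qed.

(** The left-hand side is a difference in the direction [v] of differences in
    the direction [w]; it is symmetric in [v] and [w], which is what makes
    mixed derivatives commute. *)
Lemma second_difference (R : realType) (U : normedModType R)
  (f fv fvw : U -> R) (x v w : U) (t : R) : 0 < t ->
  (forall y, is_derive y v f (fv y)) -> (forall y, is_derive y w fv (fvw y)) ->
  exists a b : R, [/\ 0 < a < t, 0 < b < t &
    f (x + t *: v + t *: w) - f (x + t *: v) - (f (x + t *: w) - f x) =
    fvw (x + a *: v + b *: w) * t * t].
Proof.
move=> t0 dv dvw.
pose h y := f (y + t *: w) - f y.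
have dh y : is_derive y v h (fv (y + t *: w) - fv y).
  by apply: is_deriveB; exact: is_derive_comp_shift.
have [a a0 Ea] := MVT_line x t0 dh.
have [b b0 Eb] := MVT_line (x + a *: v) t0 dvw.
by exists a, b; split=> //; rewrite -Eb -Ea.
Qed.

(** Second differences at arbitrarily small scale [t] are [t ^ 2] times a value
    of [fvw] near [x] and also [t ^ 2] times a value of [fwv] near [x]; by
    continuity these values cannot stay apart. *)
Lemma mixed_derivatives_commute (R : realType) (U : normedModType R)
  (f fv fw fvw fwv : U -> R) (x v w : U) :
  (forall y, is_derive y v f (fv y)) -> (forall y, is_derive y w f (fw y)) ->
  (forall y, is_derive y w fv (fvw y)) -> (forall y, is_derive y v fw (fwv y)) ->
  {for x, continuous fvw} -> {for x, continuous fwv} -> fvw x = fwv x.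
Proof.
move=> dv dw dvw dwv cvw cwv; apply/eqP/negPn/negP => neq.
pose e := `|fvw x - fwv x| / 2.
have e0 : 0 < e by rewrite divr_gt0 // normr_gt0 subr_eq0.
have /cvgrPdist_lt/(_ _ e0) nvw := cvw.
have /cvgrPdist_lt/(_ _ e0) nwv := cwv.
have : \forall y \near x, `|fvw x - fvw y| < e /\ `|fwv x - fwv y| < e.
  exact: filterI nvw nwv.
move=> /nbhs_ballP[r /= r0 rP].
pose t := r / (`|v| + `|w| + 1).
have k0 : 0 < `|v| + `|w| + 1 by rewrite ltr_wpDl // addr_ge0.
have t0 : 0 < t by rewrite divr_gt0.
have near (a b : R) :
    0 < a < t -> 0 < b < t -> ball x r (x + a *: v + b *: w).
  move=> /andP[a0 at_] /andP[b0 bt]; rewrite -ball_normE /= -addrA opprD addNKr.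
  rewrite normrN (le_lt_trans (ler_normD _ _)) // !normrZ !gtr0_norm //.
  have -> : r = t * `|v| + t * `|w| + t.
    by rewrite /t; field; rewrite gt_eqF.
  by rewrite ltr_pwDr // lerD // ler_wpM2r // ltW.
have [a [b [a0 b0 E1]]] := second_difference x t0 dv dvw.
have [b' [a' [b0' a0' E2]]] := second_difference x t0 dw dwv.
have E : fvw (x + a *: v + b *: w) = fwv (x + b' *: w + a' *: v).
  do 2!apply: (mulIf (lt0r_neq0 t0)).
  by rewrite -E1 -E2 (addrAC x (t *: w)); ring.
have [/= n1 _] := rP _ (near _ _ a0 b0).
have [/= _ n2] := rP _ (near _ _ a0' b0').
rewrite addrAC -E in n2.
have := ltrD n1 n2; rewrite -splitr ltNge => /negP; apply.
by rewrite (distrC (fwv x)) -(subrKA (fvw (x + a *: v + b *: w))) ler_normD.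
Qed.

(** * Product rule and homogeneity *)

Lemma is_derive_biscalar (R : realType) (U : normedModType R) (n : nat)
  (B : {biscalar 'rV[R]_n}) (F H : U -> 'rV[R]_n) (x v : U)
  (dF dH : 'rV[R]_n) :
  is_derive x v F dF -> is_derive x v H dH ->
  is_derive x v (fun y => B (F y) (H y)) (B dF (H x) + B (F x) dH).
Proof.
have BE a b : B a b = \sum_i \sum_j
    (a ord0 i * b ord0 j) * B (delta_mx 0 i) (delta_mx 0 j).
  rewrite {1}[a]row_sum_delta linear_sumlz; apply: eq_bigr => i _.
  rewrite {1}[b]row_sum_delta linear_sumr; apply: eq_bigr => j _.
  by rewrite linearZl_LR linearZr_LR /= mulrA.
have coord (K : U -> 'rV[R]_n) dK i :
    is_derive x v K dK -> is_derive x v (fun y => K y ord0 i) (dK ord0 i).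
  move=> [K1 <-]; rewrite derive_mx // mxE.
  by apply: derivableP; move/derivable_mxP: K1.
move=> F1 H1.
have -> : (fun y => B (F y) (H y)) = \sum_i \sum_j
    (((fun y => F y ord0 i) * (fun y => H y ord0 j)) *
      cst (B (delta_mx 0 i) (delta_mx 0 j))).
  apply/funext => y; rewrite BE fct_sumE; apply: eq_bigr => i _.
  by rewrite fct_sumE.
(* The derivative of the sum is inferred from [coord] by instance search. *)
apply: is_derive_eq.
rewrite !BE -big_split; apply: eq_bigr => i _ /=.
rewrite -big_split; apply: eq_bigr => j _ /=.
rewrite /cst /= /GRing.scale /=; ring.
Qed.

(** By Euler's equation [h t / t] is constant for [t > 0]; its value at 1 is
    [h 1] and its limit at 0 is the derivative of [h] there, as [h 0 = 0]. *)
Lemma euler_homogeneous (R : realType) (h dh : R -> R) :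
  (forall t : R, is_derive t 1 h (dh t)) -> (forall t, t * dh t = h t) ->
  h 1 = dh 0.
Proof.
move=> hD hE.
have h0 : h 0 = 0 by rewrite -hE mul0r.
have hs (s : R) : 0 < s -> s < 1 -> s^-1 * h s = h 1.
  move=> s0 s1.
  pose q (t : R) := t^-1 * h t.
  have qD (t : R) : 0 < t -> is_derive t 1 q 0.
    move=> t0; have tn0 : t != 0 by rewrite gt_eqF.
    have iD : is_derive t 1 (fun t : R => t^-1) (- t ^- 2).
      split; first by apply: derivableV => //; exact: derivable_id.
      by rewrite deriveV //= ?derive_id ?[_ *: 1]mulr1.
    apply: (is_derive_eq (is_deriveM iD (hD t))).
    by rewrite /GRing.scale /= -hE; field.
  have [||c _] := @MVT R q (fun=> 0) s 1 s1.
  - by move=> t; rewrite in_itv /= => /andP[st _]; apply: qD; exact: lt_trans st.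
  - apply: derivable_within_continuous => t; rewrite in_itv /= => /andP[st _].
    by have [] := qD t (lt_le_trans s0 st).
  by rewrite mul0r => /eqP; rewrite subr_eq0 /q invr1 mul1r => /eqP ->.
have [d0 <-] := hD 0.
rewrite /derive cvg_at_rightE //; apply/esym/cvg_lim => //.
apply: cvg_near_cst; near=> s.
rewrite /= addr0 h0 subr0 [s *: 1]mulr1; apply: hs; near: s.
  exact: nbhs_right_gt.
exact: nbhs_right_lt.
Unshelve. all: by end_near. Qed.

(** * Maps preserving the Liouville form in coordinates *)

Section LiouvillePreserving.
Context (R : realType) (n : nat) (B : {biscalar 'rV[R]_n}).
Context (altB : forall x, B x x = 0).
Context (regB : forall x, (forall y, B x y = 0) -> x = 0).
Context (G : 'rV[R]_n -> 'rV[R]_n) (G2 : Ck 2 G).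
Context (GB : forall z v, B (G z) ('D_v G z) = B z v).

Let asymB x y : B x y = - B y x.
Proof.
have := altB (x + y); rewrite linearDl /= !linearDr /= !altB add0r addr0.
by move/eqP; rewrite addr_eq0 => /eqP.
Qed.

Let is_derive_G z v : is_derive z v G ('D_v G z).
Proof. by case: G2 => dG _; exact/derivableP/diff_derivable. Qed.

Let is_derive_DG z v w :
  is_derive z w (fun y => 'D_v G y) ('D_w (fun y => 'D_v G y) z).
Proof. by case: G2 => _ /(_ v)[dG _]; exact/derivableP/diff_derivable. Qed.

Let is_derive_Bl c x v F dF : is_derive x v F dF ->
  is_derive x v (fun y : 'rV[R]_n => B c (F y)) (B c dF).
Proof.
move=> FD; have := is_derive_biscalar B (is_derive_cst c x v) FD.
by rewrite linear0l add0r.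
Qed.

Let mixedB c z v w :
  B c ('D_w (fun y => 'D_v G y) z) = B c ('D_v (fun y => 'D_w G y) z).
Proof.
have cB : continuous (B c : _ -> R^o).
  pose L : {linear 'rV[R]_n -> R^o} := HB.pack (B c : _ -> R^o)
    (GRing.isLinear.Build _ _ _ _ (B c : _ -> R^o) (linearPr B c)).
  exact: (@linear_rV_continuous R n R^o L).
have cD v' w' :
    {for z, continuous (fun y => B c ('D_w' (fun x => 'D_v' G x) y))}.
  case: G2 => _ /(_ v')[_ /(_ w') cG].
  by apply: continuous_comp; [exact: cG|exact: cB].
exact: (mixed_derivatives_commute
  (fun y => is_derive_Bl c (is_derive_G y v))
  (fun y => is_derive_Bl c (is_derive_G y w))
  (fun y => is_derive_Bl c (is_derive_DG y v w))
  (fun y => is_derive_Bl c (is_derive_DG y w v)) (cD v w) (cD w v)).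
Qed.

(** This is naturality of the exterior derivative, [B] being the exterior
    derivative of the one-form [v |-> B z v / 2] at [z]. *)
Lemma tangent_symplectic z v w : B ('D_w G z) ('D_v G z) = B w v.
Proof.
have dB v' w' :
    B ('D_w' G z) ('D_v' G z) + B (G z) ('D_w' (fun y => 'D_v' G y) z) =
    B w' v'.
  have := is_derive_biscalar B (is_derive_G z w') (is_derive_DG z v' w').
  have -> : (fun y => B (G y) ('D_v' G y)) = fun y => B y v'.
    by apply/funext => y; exact: GB.
  move=> [_ <-].
  have := is_derive_biscalar B (is_derive_id z w') (is_derive_cst v' z w').
  by move=> [_ ->]; rewrite linear0r addr0.
have solve (a a' b b' p p' : R) :
    a + p = b -> a' + p' = b' -> p = p' -> a' = - a -> b' = - b -> a = b.
  by lra.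
exact: solve (dB v w) (dB w v) (mixedB (G z) z v w) (asymB _ _) (asymB _ _).
Qed.

(** Up to a factor 2 the Euler field is dual to the one-form under [B], so a
    map that preserves both forms preserves it. *)
Lemma euler_field_preserved z : 'D_z G z = G z.
Proof.
case: (G2) => dG _.
have inj u : 'd G z u = 0 -> u = 0.
  move=> u0; apply: regB => y.
  by rewrite -(tangent_symplectic z) [in X in B X]deriveE // u0 linear0l.
apply/eqP; rewrite -subr_eq0; apply/eqP; apply: regB => y.
have [v <-] := injective_linear_rV_surj inj y.
by rewrite -deriveE // linearBl /= tangent_symplectic GB subrr.
Qed.

Lemma eq_derive0 z : G z = 'D_z G 0.
Proof.
case: (G2) => dG _.
apply/eqP; rewrite -subr_eq0; apply/eqP; apply: regB => c.
rewrite asymB linearBr; apply/eqP; rewrite oppr_eq0 subr_eq0; apply/eqP.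
have := @euler_homogeneous R (fun t => B c (G (t *: z)))
  (fun t => B c ('D_z G (t *: z))).
rewrite scale1r scale0r; apply => t.
  have := @is_derive_comp_line R _ _ (fun y => B c (G y)) 0 z t
    (B c ('D_z G (t *: z))).
  rewrite add0r => /(_ (is_derive_Bl c (is_derive_G _ z))).
  by under eq_fun do rewrite add0r.
rewrite -linearZr_LR /= -[X in _ = B c X]euler_field_preserved.
by rewrite !deriveE // [in RHS]linearZ.
Qed.

End LiouvillePreserving.

Theorem theorem0p3 (R : realType) (V : vectType R) (Omega : {biscalar V})
  (hOmega : symplectic_form Omega) : Aut (liouville Omega) = Sp Omega.
Proof.
case: hOmega => alt reg.
apply/seteqP; split=> g.
- move=> [[sg [h [gK hK _]]] pg].
  pose f (x y : 'rV[R]_(dim V)) : R := Omega (r2v x) (r2v y).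
  have bilinf : bilinear_for *%R *%R f.
    by split=> [u|u] a x y; rewrite /f linearP ?linearPl ?linearPr.
  pose B : {biscalar 'rV[R]_(dim V)} :=
    HB.pack f (bilinear_isBilinear.Build _ _ _ _ _ _ f bilinf).
  have altB x : B x x = 0 by exact: alt.
  have regB x : (forall y, B x y = 0) -> x = 0.
    move=> xy; apply: (can_inj r2vK); rewrite linear0; apply: reg => y.
    by have := xy (v2r y); rewrite /= /f v2rK.
  pose G := in_charts g.
  have gE z : g z = r2v (G (v2r z)) by rewrite /G /in_charts /= !v2rK.
  have G2 : Ck 2 G := sg 2%N.
  have dG x : differentiable G x by case: G2.
  have half0 : (2^-1 : R) != 0 by rewrite invr_eq0 pnatr_eq0.
  have GB z v : B (G z) ('D_v G z) = B z v.
    have := congr1 (fun k => k (r2v z) (r2v v)) pg.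
    rewrite /pullback /= /liouville_val /tangent_map !r2vK => /(mulfI half0).
    by rewrite -deriveE // gE r2vK.
  have GE := eq_derive0 altB regB G2 GB.
  split.
  + move=> a x y; rewrite !gE -linearP; congr r2v.
    by rewrite linearP GE [G (v2r x)]GE [G (v2r y)]GE !deriveE // linearP.
  + by exists h.
  + move=> x y; rewrite !gE.
    have := tangent_symplectic altB G2 GB 0 (v2r y) (v2r x).
    by rewrite -!GE /= /f !v2rK.
- move=> [lg [h gK hK] gO].
  have lh : linear h.
    by move=> a x y; apply: (can_inj gK); rewrite hK lg !hK.
  split; first split.
  + exact: smooth_linear.
  + by exists h; split=> //; exact: smooth_linear.
  + apply/funext => z; apply/funext => v.
    by rewrite /pullback tangent_map_linear //= /liouville_val gO.
Qed.
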